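(* Fix $\beta\in(0,1)$. For each integer $n\ge3$ let $r(n,\beta)\in(0,1)$ be a radial coordinate of a non-trivial critical point of $U_\beta$ (for the regular $n$-gon) on a perpendicular bisector to the sides. Then $$\lim_{n\to\infty}r(n,\beta)=1.$$
   Context: Positive unit point charges are placed at the vertices $\zeta_n^j=e^{2\pi i j/n}$, $j=1,\dots,n$, of a regular $n$-gon inscribed in the unit circle, $n\ge 3$. For $z=re^{i\theta}$ with $r\in[0,1)$, $\theta\in[0,2\pi)$, the Riesz potential is $$U_\beta(r,\theta)=\sum_{j=1}^n|z-\zeta_n^j|^{-2\beta}=\sum_{j=1}^n\frac{1}{(1+r^2-2r\cos(2\pi j/n-\theta))^{\beta}}.$$ It is regarded as a smooth function on the open unit disc in $\mathbb{R}^2\cong\mathbb{C}$; a critical point is a point of the open unit disc where its gradient vanishes. A critical point is called non-trivial if it is different from the origin. The perpendicular bisectors to the sides of the polygon are understood as the rays from the origin $\theta=\pi k/n$, $k=1,3,5,\dots,2n-1$. If there are several non-trivial critical points on the bisectors, $r(n,\beta)$ denotes an arbitrary choice among their radial coordinates. *)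

(* Defs.v *)
From Stdlib Require Export Reals Arith.
From Coquelicot Require Export Coquelicot.
Open Scope R_scope.

Definition polar (r theta : R) : C := (r * cos theta, r * sin theta).

Definition charge (n j : nat) : C := polar 1 (2 * PI * INR j / INR n).

(* [Rpower 0 _] takes the junk value 1, but no charge lies in the open disc. *)
Definition riesz_potential (n : nat) (beta : R) (z : C) : R :=
  sum_n_m (fun j => Rpower (Cmod (z - charge n j)) (- (2 * beta))) 1 n.

(* The domain is the open unit disc, and the gradient is taken with respect to
   the Cartesian coordinates of R^2; [is_derive] also asserts that the partial
   derivatives exist. *)
Definition critical_point (U : C -> R) (z : C) : Prop :=
  Cmod z < 1 /\
  is_derive (fun x : R => U (x, Im z)) (Re z) 0 /\
  is_derive (fun y : R => U (Re z, y)) (Im z) 0.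

Definition nontrivial_critical_point (U : C -> R) (z : C) : Prop :=
  critical_point U z /\ z <> RtoC 0.

Definition bisector_angle (n : nat) (theta : R) : Prop :=
  exists k : nat, Nat.Odd k /\ (1 <= k <= 2 * n - 1)%nat /\
    theta = PI * INR k / INR n.

Definition bisector_critical_radius (n : nat) (beta r : R) : Prop :=
  0 < r < 1 /\
  exists theta : R, bisector_angle n theta /\
    nontrivial_critical_point (riesz_potential n beta) (polar r theta).

(* Main.v *)
Require Import Defs.
From Stdlib Require Import Reals Lra Lia.
From Coquelicot Require Import Coquelicot.
Open Scope R_scope.

(** Fix rho < 1. At a critical point of radius r <= rho, the sum over the
    charges of t * d/dt of the potential vanishes for t = r, and it vanishes for
    t = 0, so by Rolle its derivative vanishes at some 0 < t < r. In polar
    coordinates that derivative is t times the Laplacian minus 1/t times the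
    second angular derivative. The Laplacian of |z|^(-2 beta) is positive and
    contributes at least c n t, whereas the n-point sum over a full period of an
    angular derivative is O(t), uniformly for t <= rho. Hence n is bounded in
    terms of rho. *)

(** * Finite sums, mean value bounds, and sums over a full period *)

Lemma is_derive_sum_n_m (f : nat -> R -> R) (f' : nat -> R) (m n : nat) (x : R) :
  (forall k, is_derive (f k) x (f' k)) ->
  is_derive (fun y => sum_n_m (fun k => f k y) m n) x (sum_n_m f' m n).
Proof.
  intros Hf.
  assert (Hempty : forall p, (p < m)%nat ->
    is_derive (fun y => sum_n_m (fun k => f k y) m p) x (sum_n_m f' m p)).
  { intros p Hp. rewrite sum_n_m_zero by exact Hp.
    apply (is_derive_ext (fun _ => zero)); [|apply (is_derive_const (V := R_NormedModule))].
    intros t. now rewrite sum_n_m_zero. }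
  induction n as [|n IH].
  - destruct m as [|m]; [|apply Hempty; lia].
    rewrite sum_n_n. apply (is_derive_ext (f 0%nat)); [|apply Hf].
    intros t. now rewrite sum_n_n.
  - destruct (le_lt_dec m (S n)) as [Hm|Hm]; [|now apply Hempty].
    rewrite sum_n_Sm by exact Hm.
    apply (is_derive_ext (fun y => plus (sum_n_m (fun k => f k y) m n) (f (S n) y))).
    + intros t. now rewrite sum_n_Sm.
    + exact (is_derive_plus _ _ _ _ _ IH (Hf (S n))).
Qed.

(** The hypothesis admits [m = S n], where the sum is empty and both sides are 0. *)
Lemma sum_n_m_telescope (u : nat -> R) (m n : nat) : (m <= S n)%nat ->
  sum_n_m (fun j => u (S j) - u j) m n = u (S n) - u m.
Proof.
  induction n as [|n IH]; intros Hm.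
  - destruct m as [|[|m]]; [| |lia].
    + now rewrite sum_n_n.
    + rewrite sum_n_m_zero by lia. unfold zero; simpl; ring.
  - destruct (Nat.eq_dec m (S (S n))) as [->|Hne].
    + rewrite sum_n_m_zero by lia. unfold zero; simpl; ring.
    + rewrite sum_n_Sm, IH by lia. unfold plus; simpl; ring.
Qed.

Lemma sum_n_m_lin (u v : nat -> R) (c : R) (m n : nat) :
  sum_n_m (fun j => u j + c * v j) m n = sum_n_m u m n + c * sum_n_m v m n.
Proof.
  change (sum_n_m (fun j => plus (u j) (mult (K := R_Ring) c (v j))) m n
          = plus (sum_n_m u m n) (mult (K := R_Ring) c (sum_n_m v m n))).
  now rewrite sum_n_m_plus, (sum_n_m_mult_l (K := R_Ring)).
Qed.

Lemma Rabs_sum_n_m_le (u : nat -> R) (M : R) (n : nat) :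
  (forall j, Rabs (u j) <= M) -> Rabs (sum_n_m u 1 n) <= INR n * M.
Proof.
  intros Hu. eapply Rle_trans; [apply (norm_sum_n_m u 1 n)|].
  eapply Rle_trans; [apply (sum_n_m_le _ (fun _ => M)); exact Hu|].
  rewrite sum_n_m_const. replace (S n - 1)%nat with n by lia. lra.
Qed.

Lemma derive_bound_lipschitz (f f' : R -> R) (L x y : R) :
  (forall c, Rmin x y <= c <= Rmax x y -> is_derive f c (f' c)) ->
  (forall c, Rmin x y <= c <= Rmax x y -> Rabs (f' c) <= L) ->
  Rabs (f y - f x) <= L * Rabs (y - x).
Proof.
  intros Hf HL.
  destruct (MVT_gen f x y f') as [c [Hc ->]].
  - intros c Hc. apply Hf. lra.
  - intros c Hc. apply derivable_continuous_pt. exists (f' c).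
    apply is_derive_Reals, Hf, Hc.
  - rewrite Rabs_mult. apply Rmult_le_compat_r; [apply Rabs_pos|auto].
Qed.

(* The sum of the increments of [h] over a full period vanishes, and each
   increment is [d * h' c] for some [c] in the step. *)
Lemma sum_periodic_derive_le (h h' : R -> R) (L A d : R) (n : nat) :
  0 < d -> INR n * d = 2 * PI ->
  (forall x, h (x + 2 * PI) = h x) ->
  (forall x, is_derive h x (h' x)) ->
  (forall x y, Rabs (h' y - h' x) <= L * Rabs (y - x)) ->
  Rabs (sum_n_m (fun j => h' (A + INR j * d)) 1 n) <= 2 * PI * L.
Proof.
  intros Hd Hn Hper Hh HL.
  assert (HL0 : 0 <= L).
  { pose proof (HL 0 1) as H. pose proof (Rabs_pos (h' 1 - h' 0)).
    replace (1 - 0) with 1 in H by ring. rewrite Rabs_R1 in H. lra. }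
  assert (Hsum : sum_n_m (fun j => h (A + INR (S j) * d) - h (A + INR j * d)) 1 n = 0).
  { rewrite (sum_n_m_telescope (fun j => h (A + INR j * d))) by lia.
    rewrite S_INR. replace (A + (INR n + 1) * d) with (A + INR 1 * d + 2 * PI).
    - rewrite Hper. apply Rminus_eq_0.
    - simpl; lra. }
  set (v := fun j => h' (A + INR j * d) - / d * (h (A + INR (S j) * d) - h (A + INR j * d))).
  assert (Hv : sum_n_m (fun j => h' (A + INR j * d)) 1 n = sum_n_m v 1 n).
  { symmetry. rewrite (sum_n_m_ext v (fun j => h' (A + INR j * d)
       + - / d * (h (A + INR (S j) * d) - h (A + INR j * d)))).
    - rewrite (sum_n_m_lin (fun j => h' (A + INR j * d))), Hsum. now rewrite Rmult_0_r, Rplus_0_r.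
    - intros j. unfold v, Rminus. now rewrite Ropp_mult_distr_l. }
  (* There are [n] corrected terms, each at most [L * d]; since [n * d] is the period, the bound
     does not depend on [n]. *)
  rewrite Hv. replace (2 * PI * L) with (INR n * (L * d)) by (rewrite <- Hn; ring).
  apply Rabs_sum_n_m_le. intros j. unfold v.
  destruct (MVT_cor2 h h' (A + INR j * d) (A + INR (S j) * d)) as [c [-> Hc]].
  - rewrite S_INR; nra.
  - intros c _. apply is_derive_Reals, Hh.
  - rewrite S_INR in *.
    replace (h' (A + INR j * d) - / d * (h' c * (A + (INR j + 1) * d - (A + INR j * d))))
      with (h' (A + INR j * d) - h' c) by (field; lra).
    eapply Rle_trans; [apply HL|]. apply Rmult_le_compat_l; [exact HL0|].
    apply Rabs_le; lra.
Qed.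

(** Multiplying by [2 * sin (d / 2)] turns each cosine into a difference of sines at half-steps,
    which telescopes over a full turn; [d < 2 * PI] makes the multiplier nonzero. *)
Lemma sum_cos_arith (A d : R) (n : nat) :
  0 < d < 2 * PI -> INR n * d = 2 * PI ->
  sum_n_m (fun j => cos (A + INR j * d)) 1 n = 0.
Proof.
  intros Hd Hn.
  assert (Hs : 0 < sin (d / 2)) by (apply sin_gt_0; lra).
  apply Rmult_eq_reg_l with (2 * sin (d / 2)); [|lra].
  transitivity (sum_n_m (fun j => sin (A + INR (S j) * d - d / 2)
                                  - sin (A + INR j * d - d / 2)) 1 n).
  - rewrite <- (sum_n_m_mult_l (K := R_Ring) (2 * sin (d / 2))).
    apply sum_n_m_ext. intros j. unfold mult; simpl Ring.mult.
    rewrite S_INR.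
    replace (A + (INR j + 1) * d - d / 2) with (A + INR j * d + d / 2) by field.
    rewrite sin_plus, sin_minus. cbn. ring.
  - rewrite (sum_n_m_telescope (fun j => sin (A + INR j * d - d / 2))) by lia.
    rewrite S_INR.
    replace (A + (INR n + 1) * d - d / 2) with (A + INR 1 * d - d / 2 + 2 * PI)
      by (simpl; lra).
    rewrite sin_plus, cos_2PI, sin_2PI. ring.
Qed.

(** * The kernel, its derivatives, and bounds uniform for radii up to [rho] *)

(** Law of cosines: squared distance to a unit charge from a point of radius [t], with [x] the angle
    between them. *)
Definition sqdist (t x : R) : R := 1 + t ^ 2 - 2 * t * cos x.

(** [sqdist t x] equals [(1 - t) ^ 2 + 2 * t * (1 - cos x)]. *)
Lemma sqdist_ge (rho t x : R) : 0 <= t <= rho -> rho < 1 -> (1 - rho) ^ 2 <= sqdist t x.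
Proof.
  intros Ht Hr. unfold sqdist. pose proof (COS_bound x). nra.
Qed.

Lemma sqdist_pos (t x : R) : 0 <= t < 1 -> 0 < sqdist t x.
Proof.
  intros Ht. pose proof (sqdist_ge t t x). nra.
Qed.

Lemma sqdist_le (t x : R) : 0 <= t < 1 -> sqdist t x <= 4.
Proof.
  intros Ht. unfold sqdist. pose proof (COS_bound x). nra.
Qed.

(** Applied with [a = beta + 1]: differentiating [sqdist ^ (-beta)] once lowers the exponent by
    one. *)
Definition kern (a t x : R) : R := Rpower (sqdist t x) (- a).

Lemma kern_pos (a t x : R) : 0 < kern a t x.
Proof. apply exp_pos. Qed.

Lemma Rpower_opp_le (a x y : R) : 0 <= a -> 0 < x <= y -> Rpower y (- a) <= Rpower x (- a).
Proof.
  intros Ha Hxy. rewrite !Rpower_Ropp.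
  apply Rinv_le_contravar; [apply exp_pos|]. now apply Rle_Rpower_l.
Qed.

Lemma is_derive_kern_angle (a t x : R) : 0 <= t < 1 ->
  is_derive (kern a t) x (- (2 * a * t * sin x * kern a t x / sqdist t x)).
Proof.
  intros Ht. pose proof (sqdist_pos t x Ht) as HD.
  unfold kern, Rpower, sqdist in *. auto_derive; [lra|].
  replace (1 + t * (t * 1) + - (2 * t * cos x)) with (1 + t ^ 2 - 2 * t * cos x) by ring.
  field. lra.
Qed.

Lemma is_derive_kern_radius (a t x : R) : 0 <= t < 1 ->
  is_derive (fun s => kern a s x) t
    (- (2 * a * (t - cos x) * kern a t x / sqdist t x)).
Proof.
  intros Ht. pose proof (sqdist_pos t x Ht) as HD.
  unfold kern, Rpower, sqdist in *. auto_derive; [lra|].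
  replace (1 + t * (t * 1) + - (2 * t * cos x)) with (1 + t ^ 2 - 2 * t * cos x) by ring.
  field. lra.
Qed.

Definition kern_max (a rho : R) : R := Rpower ((1 - rho) ^ 2) (- a).

Lemma kern_le (a rho t x : R) : 0 <= a -> 0 <= t <= rho -> rho < 1 ->
  kern a t x <= kern_max a rho.
Proof.
  intros Ha Ht Hr. apply Rpower_opp_le; [exact Ha|].
  split; [nra|now apply sqdist_ge].
Qed.

Lemma kern_ge (a t x : R) : 0 <= a -> 0 <= t < 1 -> Rpower 4 (- a) <= kern a t x.
Proof.
  intros Ha Ht. apply Rpower_opp_le; [exact Ha|].
  split; [now apply sqdist_pos|now apply sqdist_le].
Qed.

Lemma kern_div_bounds (a rho t x : R) : 0 <= a -> 0 <= t <= rho -> rho < 1 ->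
  0 <= kern a t x / sqdist t x <= kern_max a rho / (1 - rho) ^ 2.
Proof.
  intros Ha Ht Hr.
  pose proof (kern_le a rho t x Ha Ht Hr). pose proof (kern_pos a t x).
  pose proof (sqdist_ge rho t x Ht Hr).
  assert (Hd : 0 < (1 - rho) ^ 2) by nra.
  assert (Hi : / sqdist t x <= / (1 - rho) ^ 2) by now apply Rinv_le_contravar.
  assert (0 < / sqdist t x) by (apply Rinv_0_lt_compat; lra).
  unfold Rdiv. split; [nra|]. apply Rmult_le_compat; lra.
Qed.

(** The kernel is 1 at radius 0, so the mean value inequality in the radius yields the factor [t];
    the 4 comes from [|s - cos x| <= 2]. *)
Lemma kern_sub_1_le (a rho t x : R) : 0 <= a -> 0 <= t <= rho -> rho < 1 ->
  Rabs (kern a t x - 1) <= 4 * a * (kern_max a rho / (1 - rho) ^ 2) * t.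
Proof.
  intros Ha Ht Hr.
  replace 1 with (kern a 0 x) at 1.
  2: { unfold kern, sqdist. replace (1 + 0 ^ 2 - 2 * 0 * cos x) with 1 by ring.
       unfold Rpower. rewrite ln_1, Rmult_0_r. apply exp_0. }
  replace t with (Rabs (t - 0)) at 2 by (rewrite Rabs_right; lra).
  apply (derive_bound_lipschitz (fun s => kern a s x)
           (fun s => - (2 * a * (s - cos x) * kern a s x / sqdist s x)));
    rewrite Rmin_left, Rmax_right by lra; intros s Hs.
  - apply is_derive_kern_radius; lra.
  - assert (Hs' : 0 <= s <= rho) by lra.
    pose proof (kern_div_bounds a rho s x Ha Hs' Hr) as Hq.
    replace (- (2 * a * (s - cos x) * kern a s x / sqdist s x))
      with ((2 * a * - (s - cos x)) * (kern a s x / sqdist s x)) by (unfold Rdiv; ring).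
    rewrite Rabs_mult, (Rabs_right (_ / _)) by lra.
    apply Rmult_le_compat; [apply Rabs_pos|lra| |lra].
    pose proof (COS_bound x). apply Rabs_le. nra.
Qed.

(* The potential is [sqdist ^ (-beta)], and its second angular derivative is a
   multiple of the angular derivative of [sin * kern (beta + 1)]. Subtracting 1
   removes the part of first order in the radius, which sums to zero over the
   polygon; what remains has a Lipschitz derivative with constant O(t). *)
Definition sin_kern (a t x : R) : R := sin x * (kern a t x - 1).

Definition sin_kern' (a t x : R) : R :=
  cos x * (kern a t x - 1) - 2 * a * t * sin x ^ 2 * kern a t x / sqdist t x.

Definition sin_kern'' (a t x : R) : R :=
  - sin x * (kern a t x - 1) - 6 * a * t * sin x * cos x * (kern a t x / sqdist t x)
  + 4 * a * (a + 1) * t ^ 2 * sin x ^ 3 * (kern a t x / sqdist t x / sqdist t x).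

Lemma is_derive_sin_kern (a t x : R) : 0 <= t < 1 ->
  is_derive (sin_kern a t) x (sin_kern' a t x).
Proof.
  intros Ht. pose proof (sqdist_pos t x Ht) as HD.
  pose proof (is_derive_kern_angle a t x Ht) as Hk.
  unfold sin_kern, sin_kern'. auto_derive.
  - eexists; exact Hk.
  - replace (Derive (fun y => kern a t y) x)
      with (- (2 * a * t * sin x * kern a t x / sqdist t x))
      by (symmetry; apply is_derive_unique; exact Hk).
    field. lra.
Qed.

Lemma is_derive_sin_kern' (a t x : R) : 0 <= t < 1 ->
  is_derive (sin_kern' a t) x (sin_kern'' a t x).
Proof.
  intros Ht. pose proof (sqdist_pos t x Ht) as HD.
  pose proof (is_derive_kern_angle a t x Ht) as Hk.
  assert (Hd : is_derive (sqdist t) x (2 * t * sin x)).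
  { unfold sqdist. auto_derive; [exact I|ring]. }
  unfold sin_kern', sin_kern''. auto_derive.
  - repeat split; try (eexists; eassumption); lra.
  - replace (Derive (fun y => kern a t y) x)
      with (- (2 * a * t * sin x * kern a t x / sqdist t x))
      by (symmetry; apply is_derive_unique; exact Hk).
    replace (Derive (fun y => sqdist t y) x) with (2 * t * sin x)
      by (symmetry; apply is_derive_unique; exact Hd).
    field. lra.
Qed.

(** The coefficient 10 is 4 + 6, from the first two terms of [sin_kern'']; the last summand bounds
    the third term. *)
Definition sin_kern_lip (a rho : R) : R :=
  let q := kern_max a rho / (1 - rho) ^ 2 in
  10 * a * q + 4 * a * (a + 1) * (q / (1 - rho) ^ 2).

Lemma Rabs_mult_le_of_le (x y M : R) : Rabs x <= 1 -> Rabs y <= M -> Rabs (x * y) <= M.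
Proof.
  intros Hx Hy. rewrite Rabs_mult. pose proof (Rabs_pos x). pose proof (Rabs_pos y). nra.
Qed.

Lemma sin_kern''_le (a rho t x : R) : 0 <= a -> 0 <= t <= rho -> rho < 1 ->
  Rabs (sin_kern'' a t x) <= sin_kern_lip a rho * t.
Proof.
  intros Ha Ht Hr.
  pose proof (kern_sub_1_le a rho t x Ha Ht Hr) as H1.
  pose proof (kern_div_bounds a rho t x Ha Ht Hr) as Hq.
  pose proof (sqdist_ge rho t x Ht Hr) as HD.
  assert (Hd : 0 < (1 - rho) ^ 2) by nra.
  assert (Hs : Rabs (sin x) <= 1) by (apply Rabs_le, SIN_bound).
  assert (Hc : Rabs (cos x) <= 1) by (apply Rabs_le, COS_bound).
  unfold sin_kern'', sin_kern_lip. cbv zeta.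
  set (Q := kern_max a rho / (1 - rho) ^ 2) in *.
  set (q := kern a t x / sqdist t x) in *.
  assert (Hw : 0 <= q / sqdist t x <= Q / (1 - rho) ^ 2).
  { assert (/ sqdist t x <= / (1 - rho) ^ 2) by now apply Rinv_le_contravar.
    assert (0 < / sqdist t x) by (apply Rinv_0_lt_compat; lra).
    unfold Rdiv. split; [nra|]. apply Rmult_le_compat; lra. }
  set (w := q / sqdist t x) in *. set (W := Q / (1 - rho) ^ 2) in *.
  assert (T1 : Rabs (- sin x * (kern a t x - 1)) <= 4 * a * Q * t).
  { apply Rabs_mult_le_of_le; [now rewrite Rabs_Ropp|exact H1]. }
  assert (T2 : Rabs (6 * a * t * sin x * cos x * q) <= 6 * a * Q * t).
  { replace (6 * a * t * sin x * cos x * q) with (sin x * (cos x * (6 * a * t * q))) by ring.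
    apply Rabs_mult_le_of_le, Rabs_mult_le_of_le; [exact Hs|exact Hc|].
    assert (0 <= 6 * a * t) by nra.
    rewrite Rabs_right by nra. nra. }
  assert (T3 : Rabs (4 * a * (a + 1) * t ^ 2 * sin x ^ 3 * w) <= 4 * a * (a + 1) * W * t).
  { replace (4 * a * (a + 1) * t ^ 2 * sin x ^ 3 * w)
      with (sin x * (sin x * (sin x * (4 * a * (a + 1) * t ^ 2 * w)))) by ring.
    do 3 (apply Rabs_mult_le_of_le; [exact Hs|]).
    assert (0 <= 4 * a * (a + 1)) by nra.
    (* One factor [t] is kept for the final bound; the other is absorbed using [t < 1]. *)
    assert (0 <= t ^ 2 * w <= t * W).
    { split; [nra|]. apply Rmult_le_compat; nra. }
    rewrite Rabs_right by nra. nra. }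
  apply Rabs_le_between in T1, T2, T3. apply Rabs_le. lra.
Qed.

Lemma sum_sin_kern'_le (a rho t A d : R) (n : nat) :
  0 <= a -> 0 <= t <= rho -> rho < 1 -> 0 < d -> INR n * d = 2 * PI ->
  Rabs (sum_n_m (fun j => sin_kern' a t (A + INR j * d)) 1 n)
  <= 2 * PI * (sin_kern_lip a rho * t).
Proof.
  intros Ha Ht Hr Hd Hn.
  apply (sum_periodic_derive_le (sin_kern a t)); [exact Hd|exact Hn| | |].
  - intros x. unfold sin_kern, kern, sqdist.
    now rewrite sin_plus, cos_plus, sin_2PI, cos_2PI, !Rmult_0_r, !Rmult_1_r,
      Rplus_0_r, Rminus_0_r.
  - intros x. apply is_derive_sin_kern. lra.
  - intros x y. apply (derive_bound_lipschitz _ (sin_kern'' a t)); intros c _.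
    + apply is_derive_sin_kern'. lra.
    + now apply sin_kern''_le.
Qed.

(* [2 * beta * radial_term (beta + 1)] is [r] times the radial derivative of the
   potential, and the formula for its derivative is the polar form of the
   Laplacian [4 * beta ^ 2 * sqdist ^ (-beta - 1)] of [sqdist ^ (-beta)]. *)
Definition radial_term (a t x : R) : R := t * (cos x - t) * kern a t x.

(** The first summand is the Laplacian part. The other two together are the angular derivative of
    [sin x * kern a t x], with [cos x] restoring what the subtracted 1 took away. *)
Lemma is_derive_radial_term (a t x : R) : 0 <= t < 1 ->
  is_derive (fun s => radial_term a s x) t
    (2 * (a - 1) * t * kern a t x + cos x + sin_kern' a t x).
Proof.
  intros Ht. pose proof (sqdist_pos t x Ht) as HD.
  pose proof (is_derive_kern_radius a t x Ht) as Hk.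
  unfold radial_term, sin_kern'. auto_derive.
  - repeat split; eexists; exact Hk.
  - replace (Derive (fun s => kern a s x) t)
      with (- (2 * a * (t - cos x) * kern a t x / sqdist t x))
      by (symmetry; apply is_derive_unique; exact Hk).
    pose proof (sin2_cos2 x) as Hsc. unfold Rsqr in Hsc.
    (* Eliminating the sine leaves a rational identity in [t], [cos x] and the kernel. *)
    replace (sin x ^ 2) with (1 - cos x ^ 2) by nra.
    generalize (kern a t x). intros k. unfold sqdist in *. field. lra.
Qed.

(** * Rolle's theorem and the resulting bound on the number of charges *)

Lemma exists_zero_deriv_of_zero (f f' : R -> R) (b : R) :
  0 < b -> f 0 = 0 -> f b = 0 -> (forall c, 0 <= c <= b -> is_derive f c (f' c)) ->
  exists c, 0 < c < b /\ f' c = 0.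
Proof.
  intros Hb H0 Hfb Hf.
  destruct (MVT_cor2 f f' 0 b Hb) as [c [Hc Hcb]].
  - intros c Hc. now apply is_derive_Reals, Hf.
  - exists c. split; [exact Hcb|].
    rewrite H0, Hfb in Hc. nra.
Qed.

(** At the Rolle point the Laplacian sum, at least a multiple of [n * t], must be cancelled by the
    angular sum, which is at most a multiple of [t]. *)
Lemma sum_radial_term_zero_bound (a rho r A d : R) (n : nat) :
  1 < a -> 0 < r <= rho -> rho < 1 -> 0 < d < 2 * PI -> INR n * d = 2 * PI ->
  sum_n_m (fun j => radial_term a r (A + INR j * d)) 1 n = 0 ->
  INR n * (2 * (a - 1) * Rpower 4 (- a)) <= 2 * PI * sin_kern_lip a rho.
Proof.
  intros Ha Hr Hrho Hd Hn Hz.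
  destruct (exists_zero_deriv_of_zero
    (fun t => sum_n_m (fun j => radial_term a t (A + INR j * d)) 1 n)
    (fun t => sum_n_m (fun j => 2 * (a - 1) * t * kern a t (A + INR j * d)
       + cos (A + INR j * d) + sin_kern' a t (A + INR j * d)) 1 n) r)
    as [t [Ht Hsum]]; [lra| |exact Hz| |].
  - rewrite (sum_n_m_ext _ (fun _ => 0)).
    + rewrite sum_n_m_const. apply Rmult_0_r.
    + intros j. unfold radial_term. now rewrite !Rmult_0_l.
  - intros t Ht. apply (is_derive_sum_n_m (fun j s => radial_term a s (A + INR j * d))).
    intros j. apply is_derive_radial_term. lra.
  - set (S := sum_n_m (fun j => kern a t (A + INR j * d)) 1 n).
    assert (Hsplit : 2 * (a - 1) * t * S
      + sum_n_m (fun j => sin_kern' a t (A + INR j * d)) 1 n = 0).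
    { rewrite <- Hsum. symmetry.
      rewrite (sum_n_m_ext _ (fun j => (cos (A + INR j * d)
        + 2 * (a - 1) * t * kern a t (A + INR j * d))
        + 1 * sin_kern' a t (A + INR j * d))).
      - rewrite (sum_n_m_lin (fun j => cos (A + INR j * d)
          + 2 * (a - 1) * t * kern a t (A + INR j * d))).
        rewrite (sum_n_m_lin (fun j => cos (A + INR j * d))).
        rewrite sum_cos_arith by assumption.
        fold S. now rewrite Rmult_1_l, Rplus_0_l.
      - intros j. rewrite Rmult_1_l. f_equal. apply Rplus_comm. }
    assert (HS : INR n * Rpower 4 (- a) <= S).
    { replace (INR n * Rpower 4 (- a)) with (sum_n_m (fun _ => Rpower 4 (- a)) 1 n).
      - apply sum_n_m_le. intros j. apply kern_ge; lra.
      - rewrite sum_n_m_const. now replace (Datatypes.S n - 1)%nat with n by lia. }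
    assert (Hk : Rabs (sum_n_m (fun j => sin_kern' a t (A + INR j * d)) 1 n)
                 <= 2 * PI * (sin_kern_lip a rho * t)) by (apply sum_sin_kern'_le; lra).
    apply Rabs_le_between in Hk.
    (* The Rolle point has no lower bound besides 0, so the angular estimate must be O(t) for this
       cancellation to give a bound free of [t]. *)
    apply Rmult_le_reg_r with t; [lra|].
    assert (2 * (a - 1) * t * (INR n * Rpower 4 (- a)) <= 2 * (a - 1) * t * S)
      by (apply Rmult_le_compat_l; [nra|exact HS]).
    lra.
Qed.

(** * From the Cartesian gradient to the radial derivative *)

(** Serves both partial derivatives: [q] stands for the squared difference in the coordinate held
    fixed. *)
Lemma is_derive_Rpower_sqrt (b u q x : R) : 0 < (x - u) ^ 2 + q ->
  is_derive (fun y => Rpower (sqrt ((y - u) ^ 2 + q)) (- (2 * b))) x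
    (- (2 * b) * ((x - u) * Rpower ((x - u) ^ 2 + q) (- (b + 1)))).
Proof.
  intros HQ.
  (* The square root is rewritten as a power only where the radicand is positive, hence only near
     [x]. *)
  apply (is_derive_ext_loc (fun y => Rpower ((y - u) ^ 2 + q) (- b))).
  - assert (Hc : continuous (fun y => (y - u) ^ 2 + q) x).
    { apply (ex_derive_continuous (V := R_NormedModule)). auto_derive. exact I. }
    assert (Hpos : locally x (fun y => 0 < (y - u) ^ 2 + q)) by exact (Hc _ (open_gt 0 _ HQ)).
    revert Hpos. apply filter_imp. intros y Hy.
    rewrite <- Rpower_sqrt by exact Hy. rewrite Rpower_mult. f_equal. field.
  - replace (- (b + 1)) with (- b + - (1)) by ring.
    rewrite Rpower_plus, (Rpower_Ropp _ 1), Rpower_1 by exact HQ.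
    unfold Rpower. auto_derive; [lra|].
    replace ((x + - u) * ((x + - u) * 1) + q) with ((x - u) ^ 2 + q) by ring.
    field. lra.
Qed.

(** The radial derivative times [r] is the combination of the two partial derivatives with the
    coordinates of the point as weights, and both partials vanish. *)
Lemma sum_radial_term_critical (n : nat) (b r theta : R) :
  0 < b -> 0 < r < 1 -> critical_point (riesz_potential n b) (polar r theta) ->
  sum_n_m (fun j => radial_term (b + 1) r (- theta + INR j * (2 * PI / INR n))) 1 n = 0.
Proof.
  intros Hb Hr [_ [Hx Hy]].
  set (al := fun j => 2 * PI * INR j / INR n).
  set (u := fun j => r * cos theta - 1 * cos (al j)).
  set (v := fun j => r * sin theta - 1 * sin (al j)).
  assert (HD : forall j, u j ^ 2 + v j ^ 2 = sqdist r (- theta + al j)).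
  { intros j. unfold u, v, sqdist. rewrite cos_plus, cos_neg, sin_neg.
    pose proof (sin2_cos2 theta) as H1. pose proof (sin2_cos2 (al j)) as H2.
    unfold Rsqr in *. nra. }
  set (K := fun j => kern (b + 1) r (- theta + al j)).
  assert (HX : sum_n_m (fun j => - (2 * b) * (u j * K j)) 1 n = 0).
  { refine (eq_trans (eq_sym _) (is_derive_unique _ _ _ Hx)).
    apply is_derive_unique.
    apply (is_derive_sum_n_m (fun j x =>
             Rpower (Cmod ((x, Im (polar r theta)) - charge n j)) (- (2 * b)))).
    intros j. unfold K, kern. rewrite <- HD.
    apply is_derive_Rpower_sqrt. change (0 < u j ^ 2 + v j ^ 2). rewrite HD. apply sqdist_pos. lra. }
  assert (HY : sum_n_m (fun j => - (2 * b) * (v j * K j)) 1 n = 0).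
  { refine (eq_trans (eq_sym _) (is_derive_unique _ _ _ Hy)).
    apply is_derive_unique.
    apply (is_derive_sum_n_m (fun j y =>
             Rpower (Cmod ((Re (polar r theta), y) - charge n j)) (- (2 * b)))).
    (* The squares are swapped so that the varying coordinate comes first, as
       [is_derive_Rpower_sqrt] expects. *)
    intros j. unfold K, kern. rewrite <- HD, Rplus_comm.
    eapply is_derive_ext; [|apply is_derive_Rpower_sqrt].
    - intros y. cbv beta. rewrite Rplus_comm. reflexivity.
    - change (0 < v j ^ 2 + u j ^ 2). rewrite Rplus_comm, HD. apply sqdist_pos. lra. }
  (* The weights cancel [- (2 * b)] up to sign, since [cos theta * u j + sin theta * v j = r - cos
     (al j - theta)]. The leading 0 gives the shape for two uses of [sum_n_m_lin]. *)
  transitivity (sum_n_m (fun j => (0 + r * cos theta / (2 * b) * (- (2 * b) * (u j * K j)))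
    + r * sin theta / (2 * b) * (- (2 * b) * (v j * K j))) 1 n).
  - apply sum_n_m_ext. intros j.
    replace (INR j * (2 * PI / INR n)) with (al j) by (unfold al, Rdiv; ring).
    unfold radial_term. fold (K j). unfold u, v.
    rewrite cos_plus, cos_neg, sin_neg.
    pose proof (sin2_cos2 theta) as H1. unfold Rsqr in H1.
    replace (r * (cos theta * cos (al j) - - sin theta * sin (al j) - r) * K j)
      with (r * (cos theta * cos (al j) - - sin theta * sin (al j)
            - r * (sin theta * sin theta + cos theta * cos theta)) * K j)
      by (rewrite H1; ring).
    apply Rminus_diag_uniq. field. lra.
  - rewrite (sum_n_m_lin (fun j => 0 + r * cos theta / (2 * b) * (- (2 * b) * (u j * K j)))).
    rewrite (sum_n_m_lin (fun _ => 0)), HX, HY, sum_n_m_const. apply Rminus_diag_uniq. ring.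
Qed.

Theorem theorem4p1 (beta : R) (hbeta : 0 < beta < 1) (r : nat -> R)
  (hr : forall n : nat, (3 <= n)%nat -> bisector_critical_radius n beta (r n)) :
  is_lim_seq r 1.
Proof.
  apply is_lim_seq_spec. intros eps.
  set (rho := 1 - Rmin eps (1 / 2)).
  assert (Hrho : 1 - eps <= rho < 1).
  { pose proof (cond_pos eps). pose proof (Rmin_l eps (1 / 2)).
    assert (0 < Rmin eps (1 / 2)) by (apply Rmin_pos; lra). unfold rho. lra. }
  (* The coefficient of [INR n] in [sum_radial_term_zero_bound] at [a = beta + 1]; [beta > 0] makes
     it positive. *)
  set (c := 2 * (beta + 1 - 1) * Rpower 4 (- (beta + 1))).
  assert (Hc : 0 < c).
  { apply Rmult_lt_0_compat; [lra|apply exp_pos]. }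
  destruct (INR_unbounded (2 * PI * sin_kern_lip (beta + 1) rho / c)) as [N HN].
  exists (max N 3). intros n Hn.
  destruct (hr n) as [Hrn [theta [_ [Hcrit _]]]]; [lia|].
  apply Rabs_lt_between'. split; [|pose proof (cond_pos eps); lra].
  (* A radius at most [rho] would force [n] below the threshold that [N] exceeds. *)
  destruct (Rle_lt_dec (r n) rho) as [Hle|Hlt]; [exfalso|lra].
  assert (HnN : INR N <= INR n) by (apply le_INR; lia).
  assert (Hn3 : 3 <= INR n) by (replace 3 with (INR 3) by (simpl; ring); apply le_INR; lia).
  pose proof PI_RGT_0 as HPI.
  assert (Hb : INR n * c <= 2 * PI * sin_kern_lip (beta + 1) rho).
  { apply (sum_radial_term_zero_bound (beta + 1) rho (r n) (- theta) (2 * PI / INR n));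
      try lra.
    - split; [apply Rdiv_lt_0_compat; lra|].
      apply Rmult_lt_reg_r with (INR n); [lra|].
      unfold Rdiv. rewrite Rmult_assoc, Rinv_l by lra. nra.
    - field. lra.
    - apply sum_radial_term_critical; [lra|exact Hrn|exact Hcrit]. }
  apply Rmult_le_compat_r with (r := / c) in Hb;
    [|left; now apply Rinv_0_lt_compat].
  rewrite Rmult_assoc, Rinv_r, Rmult_1_r in Hb by lra.
  unfold Rdiv in HN. lra.
Qed.
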